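(* Let $k\ge 50$ and $\Delta\ge 1$ be integers and let $q$ be an integer with $q\ge 700\,\Delta^{\frac{5}{k-10}}$. Let $H=(V,\mathcal{E})$ be a $k$-uniform hypergraph with maximum degree $\Delta$. Then $Z^{\mathrm{co}}_H(\lambda)\neq 0$ for every $\lambda\in\mathbb{C}$ for which there exists $\lambda_c\in[0,1]$ with $|\lambda-\lambda_c|\le \frac{1}{16\Delta^2k^5}$.
   Context: A hypergraph $H=(V,\mathcal{E})$ is $k$-uniform if every hyperedge has exactly $k$ vertices; its maximum degree is the maximum over vertices of the number of hyperedges containing the vertex. A coloring $\sigma\in[q]^V$ is proper if no hyperedge is monochromatic. The partition function is $Z^{\mathrm{co}}_H(\lambda)=\sum_{\sigma\in[q]^V\ \text{proper}}\lambda^{|\sigma^{-1}(1)|}$, where $\sigma^{-1}(1)=\{v\in V:\sigma(v)=1\}$. *)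

(* Defs.v *)
From mathcomp Require Import all_boot all_order all_algebra.
From mathcomp Require Import all_classical all_reals all_analysis.
From mathcomp Require Import complex.
Set Implicit Arguments.
Unset Strict Implicit.
Unset Printing Implicit Defensive.
Import Order.TTheory GRing.Theory Num.Theory.
Local Open Scope ring_scope.

Section Hypergraph.

(* A finite hypergraph on the vertex set V is given by its set of hyperedges. *)
Variables (V : finType) (E : {set {set V}}).

Definition uniform (k : nat) : Prop := forall e : {set V}, e \in E -> #|e| = k.

Definition degree (v : V) : nat := #|[set e in E | v \in e]|.

Definition max_degree : nat := (\max_(v : V) degree v)%N.

Section Coloring.
Variables (q : nat) (sigma : {ffun V -> 'I_q}).

Definition monochromatic (e : {set V}) : bool :=
  [exists c : 'I_q, forall v in e, sigma v == c].

Definition proper_coloring : bool := [forall e in E, ~~ monochromatic e].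

(* The colors {1, ..., q} are represented by 'I_q with the index shifted by one,
   so that the distinguished color 1 is the element of 'I_q of value 0. *)
Definition first_color_class : {set V} := [set v | val (sigma v) == 0%N].

End Coloring.

Definition Zco (R : realType) (q : nat) (lambda : R[i]) : R[i] :=
  \sum_(sigma : {ffun V -> 'I_q} | proper_coloring sigma)
     lambda ^+ #|first_color_class sigma|.

End Hypergraph.

(* Main.v *)
Require Import Defs.
From mathcomp Require Import all_classical all_reals all_analysis.
From mathcomp Require Import complex.
From mathcomp Require Import all_boot all_order all_algebra.
From mathcomp Require Import ring lra zify.
Import Order.TTheory GRing.Theory Num.Theory.
Local Open Scope ring_scope.
Local Open Scope complex_scope.
Import ComplexField.Normc.

Set Implicit Arguments.
Unset Strict Implicit.
Unset Printing Implicit Defensive.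

(**
  The proof is a maximum principle. For a set F of hyperedges and a partial
  colouring c, let Z(F, c) be the sum over the proper colourings of F that
  extend c. A positive weight W(F, c) is the product of color_bound over the
  pinned vertices times the exponential of a sum of energies over the edges of
  F whose pinned vertices all have one colour; the energy of such an edge grows
  geometrically with its number m of pinned vertices, until m = h = k/5.
  Take (F, c) maximizing |Z| / W. If an edge carrying energy has at least h
  pinned vertices, then revealing the colour of another of its vertices
  lowers the total weight, since most colours satisfy the edge and cancel its
  energy. If it has between 1 and h - 1 of them, deleting it changes Z by a
  monochromatic term, which is too small to make up for the lost energy.
  If neither occurs but c is not empty, a pinned vertex lies only on satisfied
  edges and can be unpinned. If c is empty, adding an edge shrinks Z by less
  than it shrinks W, because an edge without pinned vertices has energy -x.
  Hence the maximum, which is positive, is attained at F = E with c empty.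
*)

(** * Partial colourings, pinned vertices and satisfied edges *)

Section PartialColorings.

Variables (V : finType) (q : nat).
Implicit Types (c : {ffun V -> option 'I_q}) (s : {ffun V -> 'I_q}).
Implicit Types (e S : {set V}) (F : {set {set V}}) (a b : 'I_q) (u v : V).

Definition compatible c v a : bool := (c v == None) || (c v == Some a).

Definition extends c s : bool := [forall v, compatible c v (s v)].

Definition pin c S a : {ffun V -> option 'I_q} :=
  [ffun v => if v \in S then Some a else c v].

Definition unpin c u : {ffun V -> option 'I_q} :=
  [ffun v => if v == u then None else c v].

Definition pinned c e : {set V} := [set v in e | c v != None].

Definition unpinned c e : {set V} := [set v in e | c v == None].

(** The pinned colours do not yet prevent [e] from becoming monochromatic. An edge without pinned
    vertices is unsatisfied as soon as a colour exists. *)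
Definition unsatisfied c e : bool :=
  [exists a, forall v in e, compatible c v a].

Definition recolor s u a : {ffun V -> 'I_q} :=
  [ffun v => if v == u then a else s v].

Lemma card_pinned_unpinned c e : (#|pinned c e| + #|unpinned c e|)%N = #|e|.
Proof.
rewrite -(cardsID [set v | c v != None] e); congr addn; apply: eq_card => v.
- by rewrite !inE.
- by rewrite !inE negbK andbC.
Qed.

Lemma extends_pin c S a s : {in S, forall v, c v = None} ->
  extends (pin c S a) s = extends c s && [forall v in S, s v == a].
Proof.
move=> cS; apply/forallP/andP => [H|[/forallP H1 /forall_inP H2] v].
  split; first (apply/forallP => v); last (apply/forall_inP => v vS).
    have := H v; rewrite /compatible ffunE; case: ifP => // vS _.
    by rewrite cS.
  by have := H v; rewrite /compatible ffunE vS /= => /eqP [->].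
rewrite /compatible ffunE; case: ifP => [vS|_]; last exact: H1.
by rewrite (eqP (H2 v vS)) eqxx orbT.
Qed.

Lemma proper_coloring_setU1 e F s :
  proper_coloring (e |: F) s = proper_coloring F s && ~~ monochromatic s e.
Proof.
apply/forall_inP/andP => [H|[/forall_inP H1 H2] f].
  split; last by apply: H; rewrite !inE eqxx.
  by apply/forall_inP => f fF; apply: H; rewrite !inE fF orbT.
by rewrite !inE => /orP [/eqP ->|/H1].
Qed.

Lemma pinned_pin1 c u a e : c u = None ->
  #|pinned (pin c [set u] a) e| = ((u \in e) + #|pinned c e|)%N.
Proof.
move=> cu.
have -> : (u \in e) = (u \in e) && (u \notin pinned c e).
  by rewrite !inE cu /= andbF andbT.
case: (boolP (u \in e)) => ue; last first.
  rewrite add0n; apply: eq_card => v; rewrite !inE ffunE !inE.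
  by case: (eqVneq v u) => // ->; rewrite (negbTE ue).
rewrite /= -cardsU1; apply: eq_card => v; rewrite !inE ffunE !inE.
by case: (eqVneq v u) => // ->; rewrite ue.
Qed.

Lemma unsatisfied_pin c S a e : {in S, forall v, c v = None} ->
  unsatisfied (pin c S a) e -> unsatisfied c e.
Proof.
move=> cS /existsP [b /forall_inP H]; apply/existsP; exists b.
apply/forall_inP => v ve; have := H v ve; rewrite /compatible ffunE.
by case: ifP => // vS _; rewrite cS.
Qed.

Lemma eq_unsatisfied c c' e :
  {in e, c =1 c'} -> unsatisfied c e = unsatisfied c' e.
Proof.
move=> H; apply: eq_existsb => a; apply: eq_forallb => v.
by case: (boolP (v \in e)) => // /H; rewrite /compatible => ->.
Qed.

Lemma eq_pinned c c' e : {in e, c =1 c'} -> pinned c e = pinned c' e.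
Proof.
by move=> H; apply/setP => v; rewrite !inE; case: (boolP (v \in e)) => // /H ->.
Qed.

Lemma pin_notin c S a e : [disjoint e & S] -> {in e, pin c S a =1 c}.
Proof.
by move=> dis v ve; rewrite ffunE (disjointFr dis ve).
Qed.

(** A vertex of [e] pinned before [u] already fixes the only colour in which [e] can become
    monochromatic. *)
Lemma unsatisfied_pin1_inj c u a b e : u \in e -> (0 < #|pinned c e|)%N ->
  c u = None ->
  unsatisfied (pin c [set u] a) e -> unsatisfied (pin c [set u] b) e -> a = b.
Proof.
move=> ue /card_gt0P [v]; rewrite !inE => /andP [ve cv] cu.
have vu : v != u by apply: contraNneq cv => ->; rewrite cu.
move=> /existsP [a' /forall_inP Ha] /existsP [b' /forall_inP Hb].
have := Ha u ue; have := Hb u ue; have := Ha v ve; have := Hb v ve.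
rewrite /compatible !ffunE !inE (negbTE vu) eqxx /= (negbTE cv) /=.
by move=> /eqP -> /eqP [->] /eqP [->] /eqP [->].
Qed.

(** * Recursions for the partition function: revealing, deleting, unpinning *)

Section PartitionFunction.

Variables (K : fieldType) (w : 'I_q -> K).

Definition partition_function F c : K :=
  \sum_(s | proper_coloring F s && extends c s) \prod_v w (s v).

Local Notation Z := partition_function.

Lemma partition_function_reveal F c u : c u = None ->
  Z F c = \sum_a Z F (pin c [set u] a).
Proof.
move=> cu; rewrite {1}/partition_function.
rewrite (partition_big (fun s : {ffun V -> 'I_q} => s u) predT) //=.
apply: eq_bigr => a _; apply: eq_bigl => s.
rewrite extends_pin => [|v /set1P -> //]; rewrite -andbA; congr (_ && (_ && _)).
apply/idP/forall_inP => [su v /set1P -> //|-> //]; exact: set11.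
Qed.

Lemma partition_function_setU1 e F c :
  Z (e |: F) c = Z F c -
    \sum_(s | proper_coloring F s && extends c s && monochromatic s e)
       \prod_v w (s v).
Proof.
rewrite {2}/partition_function (bigID (fun s => monochromatic s e)) /=.
rewrite addrC addrK; apply: eq_bigl => s.
by rewrite proper_coloring_setU1 andbAC.
Qed.

(** The colourings lost by adding [e] are monochromatic on it, necessarily in the colour of [v];
    this amounts to pinning the rest of [e] to [a]. *)
Lemma partition_function_setU1_pinned e F c v a :
  v \in e -> c v = Some a -> {in e, forall u, compatible c u a} ->
  Z (e |: F) c = Z F c - Z F (pin c (unpinned c e) a).
Proof.
move=> ve cv ca; rewrite partition_function_setU1; congr (_ - _).
apply: eq_bigl => s; rewrite -andbA; congr (_ && _).
rewrite extends_pin => [|u]; last by rewrite !inE => /andP [_ /eqP].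
case: (boolP (extends c s)) => //= /forallP cs.
apply/existsP/forall_inP => [[b /forall_inP sb] u|sa].
  rewrite !inE => /andP [ue _]; rewrite (eqP (sb u ue)).
  have := cs v; rewrite /compatible cv /= => /eqP [->]; by rewrite eq_sym sb.
exists a; apply/forall_inP => u ue.
have := ca u ue; rewrite /compatible.
case: (eqVneq (c u) None) => [cu _|cu /= /eqP cua].
  by apply: sa; rewrite !inE ue cu.
by have := cs u; rewrite /compatible cua /= => /eqP [->].
Qed.

(** Here any colour may be the common one; it is read off at a vertex of [e], so nonemptiness makes
    the classes disjoint. *)
Lemma partition_function_setU1_unpinned e F c : e != set0 ->
  {in e, forall u, c u = None} ->
  Z (e |: F) c = Z F c - \sum_a Z F (pin c e a).
Proof.
move=> /set0Pn [v ve] ce; rewrite partition_function_setU1; congr (_ - _).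
rewrite (partition_big (fun s : {ffun V -> 'I_q} => s v) predT) //=.
apply: eq_bigr => a _; apply: eq_bigl => s.
rewrite extends_pin // -!andbA; congr (_ && (_ && _)).
apply/andP/forall_inP => [[/existsP [b /forall_inP sb] /eqP <-] u ue|sa].
  by rewrite (eqP (sb u ue)) (eqP (sb v ve)).
by split; [apply/existsP; exists a; apply/forall_inP | exact: sa].
Qed.

Lemma partition_function_satisfied F c :
  Z F c = Z [set e in F | unsatisfied c e] c.
Proof.
apply: eq_bigl => s; case: (boolP (extends c s)); rewrite ?andbF // !andbT.
move=> /forallP cs; apply/forall_inP/forall_inP => H e.
  by rewrite inE => /andP [/H].
move=> eF; case: (boolP (unsatisfied c e)) => [ec|]; first by apply: H; rewrite inE eF.
apply: contra => /existsP [a /forall_inP sa]; apply/existsP; exists a.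
by apply/forall_inP => v ve; rewrite -(eqP (sa v ve)).
Qed.

(** No edge of [F] sees [u], so recolouring [u] is a bijection that changes only its own factor.
    Cross-multiplication avoids dividing by a weight that may vanish. *)
Lemma partition_function_recolor F c u a b :
  c u = None -> {in F, forall e, u \notin e} ->
  w a * Z F (pin c [set u] b) = w b * Z F (pin c [set u] a).
Proof.
move=> cu Fu; rewrite /partition_function !mulr_sumr.
have cS : {in [set u], forall v, c v = None} by move=> v /set1P ->.
have ext s d : extends (pin c [set u] d) s = extends c s && (s u == d).
  rewrite extends_pin //; congr andb.
  by apply/forall_inP/idP => [-> //|sd v /set1P -> //]; exact: set11.
rewrite (reindex_onto (fun s => recolor s u b) (fun s => recolor s u a)) /=; last first.
  move=> s; rewrite ext => /andP [_ /andP [_ /eqP su]].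
  by apply/ffunP => v; rewrite !ffunE; case: (eqVneq v u) => // ->.
have rec s d : s u = a -> recolor (recolor s u d) u a = s.
  move=> su; apply/ffunP => v; rewrite !ffunE; case: (eqVneq v u) => // -> //.
apply: eq_big => [s|s /andP [_ /eqP sa]].
  rewrite !ext ffunE eqxx eqxx andbT.
  have -> : (recolor (recolor s u b) u a == s) = (s u == a).
    apply/eqP/eqP => [<-|/rec ->//]; by rewrite ffunE eqxx.
  have -> : extends c (recolor s u b) = extends c s.
    apply: eq_forallb => v; rewrite /compatible ffunE.
    by case: (eqVneq v u) => // ->; rewrite cu.
  rewrite -andbA; congr (_ && _).
  apply: eq_forallb => e; case: (boolP (e \in F)) => //= eF; congr (~~ _).
  apply: eq_existsb => d; apply: eq_forallb => v.
  case: (boolP (v \in e)) => //= ve; rewrite ffunE; case: (eqVneq v u) => // vu.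
  by have := Fu e eF; rewrite -vu ve.
have su : s u = a by rewrite -sa ffunE eqxx.
rewrite (bigD1 u) //= [in RHS](bigD1 u) //= ffunE eqxx su mulrCA.
congr (_ * (_ * _)); apply: eq_bigr => v vu; by rewrite ffunE (negbTE vu).
Qed.

Lemma partition_function_unpin F c u a :
  c u = Some a -> {in F, forall e, u \notin e} ->
  (\sum_b w b) * Z F c = w a * Z F (unpin c u).
Proof.
move=> cu Fu.
have cu0 : unpin c u u = None by rewrite ffunE eqxx.
rewrite (partition_function_reveal F cu0) mulr_suml mulr_sumr.
have pc : pin (unpin c u) [set u] a = c.
  by apply/ffunP => v; rewrite !ffunE !inE; case: (eqVneq v u) => // ->.
apply: eq_bigr => b _; rewrite -{1}pc; symmetry; exact: partition_function_recolor.
Qed.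

End PartitionFunction.

End PartialColorings.

(** * The comparison weight: effect of pinning and of revealing a colour *)

Section Weights.

Variables (V : finType) (q : nat) (R : realType).
Variables (beta : 'I_q -> R) (r x eta : R) (D h : nat) (E : {set {set V}}).
Implicit Types (c : {ffun V -> option 'I_q}) (e S : {set V}).
Implicit Types (F : {set {set V}}) (a : 'I_q) (u : V).

Hypotheses (D_gt0 : (0 < D)%N) (h_gt0 : (0 < h)%N) (r_ge1 : 1 <= r).
Hypotheses (x_ge0 : 0 <= x) (eta_ge0 : 0 <= eta).
Hypotheses (beta_gt0 : forall a, 0 < beta a).
Hypotheses (beta_le : forall a, beta a * (4 * r) <= 1).
Hypotheses (sum_beta : \sum_a beta a <= 1 + eta).
Hypotheses (deg_le : forall v, (#|[set e in E | v \in e]| <= D)%N).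

(** Truncated subtraction makes this constant for [m >= h]. The cap [1 / (2 D)] keeps the total
    energy of the at most [D] edges at a vertex below or equal to 1/2. *)
Definition energy (m : nat) : R :=
  if m == 0%N then - x else (2 * D%:R)^-1 * r ^- (h - m).

(** Pinning a vertex lifts its previously unpinned edges from [- x] to at most [energy 1]. This gain
    and the excess [eta] must stay below half the cap [1 / (2 D)]. *)
Hypothesis smallness : D%:R * (energy 1 + x) + eta < (4 * D%:R)^-1.

Definition edge_energy c e : R :=
  if unsatisfied c e then energy #|pinned c e| else 0.

Definition weight F c : R :=
  (\prod_v oapp beta 1 (c v)) * expR (\sum_(e in F) edge_energy c e).

Let d_gt0 : 0 < D%:R :> R.
Proof. by rewrite ltr0n. Qed.

Let r_gt0 : 0 < r.
Proof. exact: lt_le_trans r_ge1. Qed.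

Lemma energy_gt0 m : (0 < m)%N -> 0 < energy m.
Proof.
move=> m_gt0; rewrite /energy gtn_eqF // mulr_gt0 // ?invr_gt0 ?exprn_gt0 //.
by rewrite mulr_gt0.
Qed.

Lemma energy_le m : energy m <= (2 * D%:R)^-1.
Proof.
have D2 : 0 < (2 * D%:R)^-1 :> R by rewrite invr_gt0 mulr_gt0.
rewrite /energy; case: eqP => _; first by rewrite (le_trans _ (ltW D2)) // oppr_le0.
rewrite ler_piMr ?(ltW D2) // invf_le1 ?exprn_gt0 //; exact: exprn_ege1.
Qed.

Lemma energy_ge m : - x <= energy m.
Proof.
case: m => [|m]; first by rewrite /energy eqxx.
by rewrite (le_trans _ (ltW (energy_gt0 (ltn0Sn m)))) // oppr_le0.
Qed.

Lemma energyS m : (0 < m)%N -> energy m.+1 <= r * energy m.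
Proof.
move=> m_gt0; rewrite /energy (gtn_eqF m_gt0) /= mulrCA ler_pM2l; last first.
  by rewrite invr_gt0 mulr_gt0.
case: (leqP h m) => hm.
  have -> : (h - m.+1 = 0)%N by apply/eqP; rewrite subn_eq0 ltnW.
  by rewrite (eqP hm) expr0 invr1 mulr1.
rewrite (_ : h - m = (h - m.+1).+1)%N; last by rewrite -subSn // subSS.
by rewrite exprS invfM mulrA divff ?gt_eqF // mul1r.
Qed.

Lemma edge_energy_le c e : edge_energy c e <= (2 * D%:R)^-1.
Proof.
rewrite /edge_energy; case: ifP => _; first exact: energy_le.
by rewrite invr_ge0 mulr_ge0.
Qed.

Lemma edge_energy_ge c e : - x <= edge_energy c e.
Proof.
by rewrite /edge_energy; case: ifP => _; rewrite ?energy_ge // oppr_le0.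
Qed.

Lemma eq_edge_energy c c' e : {in e, c =1 c'} -> edge_energy c e = edge_energy c' e.
Proof.
by move=> cc'; rewrite /edge_energy (eq_unsatisfied cc') (eq_pinned cc').
Qed.

Lemma weight_gt0 F c : 0 < weight F c.
Proof.
rewrite mulr_gt0 ?expR_gt0 // prodr_gt0 // => v _.
by case: (c v) => [a|] /=.
Qed.

Lemma prod_pin c S a : {in S, forall v, c v = None} ->
  \prod_v oapp beta 1 (pin c S a v) =
  beta a ^+ #|S| * \prod_v oapp beta 1 (c v).
Proof.
move=> cS; rewrite (bigID (mem S)) /= [in RHS](bigID (mem S)) /= -prodr_const.
rewrite [X in _ = _ * (X * _)]big1 ?mul1r => [|v /cS -> //].
congr (_ * _); apply: eq_bigr => v; rewrite ffunE; first by move->.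
by move/negbTE => ->.
Qed.

Lemma sum_incident F u (y : R) : F \subset E -> 0 <= y ->
  \sum_(e in F) (u \in e)%:R * y <= D%:R * y.
Proof.
move=> FE y_ge0; rewrite -mulr_suml ler_wpM2r // -natr_sum ler_nat.
apply: leq_trans (deg_le u).
have -> : (\sum_(e in F) (u \in e) = #|[set e in F | u \in e]|)%N.
  by rewrite -sum1dep_card big_mkcondr; apply: eq_bigr => e _; case: (u \in e).
apply: subset_leq_card; apply/subsetP => e; rewrite !inE => /andP [eF ->].
by rewrite (subsetP FE _ eF).
Qed.

(** Each new pin costs a factor [beta a] and raises at most [D] edges by at most [y], hence a factor
    at most [expR (3 / 4) <= 4]; [beta_le] absorbs the 4. *)
Lemma weight_pin_le F c S a : F \subset E -> {in S, forall v, c v = None} ->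
  weight F (pin c S a) <= r ^- #|S| * weight F c.
Proof.
move=> FE cS; rewrite /weight prod_pin // mulrCA -!mulrA.
rewrite [leLHS]mulrCA ler_wpM2l //.
  by apply: prodr_ge0 => v _; case: (c v) => [b|] //=; exact: ltW.
set y : R := (2 * D%:R)^-1 + x.
have y_ge0 : 0 <= y by rewrite addr_ge0 // invr_ge0 mulr_ge0.
(* The cap contributes 1/2 and [smallness] bounds [D x] by 1/4. *)
have Dy : D%:R * y <= 3 / 4.
  have De1 : 0 < D%:R * energy 1 by rewrite mulr_gt0 ?energy_gt0.
  have D4 : (4 * D%:R)^-1 <= 1 / 4 :> R.
    by rewrite div1r lef_pV2 ?posrE ?mulr_gt0 // ler_peMr // ler1n.
  have D2 : D%:R * (2 * D%:R)^-1 = 1 / 2 :> R.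
    by rewrite invfM mulrCA divff ?gt_eqF // mulr1 div1r.
  have := smallness; rewrite /y !mulrDr D2.
  move: De1 D4 eta_ge0; move: (D%:R * energy 1) (D%:R * x) (4 * D%:R)^-1 => e1 dx d4; lra.
have H : \sum_(e in F) edge_energy (pin c S a) e <=
         \sum_(e in F) edge_energy c e + #|S|%:R * (3 / 4).
  apply: (@le_trans _ _ (\sum_(e in F) (edge_energy c e + \sum_(u in S) (u \in e)%:R * y))).
    apply: ler_sum => e _; case: (boolP [disjoint e & S]) => [dis|].
      rewrite (eq_edge_energy (pin_notin c a dis)) lerDl sumr_ge0 // => u _.
      by rewrite mulr_ge0.
    rewrite -setI_eq0 => /set0Pn [u]; rewrite inE => /andP [ue uS].
    rewrite (bigD1 u) //= ue mul1r addrA -[leLHS]addr0 lerD //; last first.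
      by apply: sumr_ge0 => v _; rewrite mulr_ge0.
    have := edge_energy_le (pin c S a) e; have := edge_energy_ge c e.
    rewrite /y; lra.
  rewrite big_split lerD2l exchange_big /= -sumr_const mulr_suml.
  apply: ler_sum => u _; rewrite mul1r; apply: le_trans Dy; exact: sum_incident.
apply: le_trans (_ : beta a ^+ #|S| * (expR (\sum_(e in F) edge_energy c e) * 4 ^+ #|S|) <= _).
  rewrite ler_wpM2l ?exprn_ge0 ?(ltW (beta_gt0 _)) //.
  apply: (@le_trans _ _ (expR (\sum_(e in F) edge_energy c e + #|S|%:R * (3 / 4)))).
    by rewrite ler_expR.
  rewrite expRD ler_wpM2l ?expR_ge0 // mulrC expRM_natr lerXn2r ?nnegrE ?expR_ge0 //.
  have := expR_ge1Dx (- (3 / 4) : R); rewrite expRN => H4.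
  rewrite -[leLHS]invrK -[leRHS]invrK lef_pV2 ?posrE ?invr_gt0 ?expR_gt0 //.
  lra.
rewrite mulrCA mulrC -exprMn -exprVn ler_wpM2r ?expR_ge0 //.
rewrite lerXn2r ?nnegrE ?mulr_ge0 ?invr_ge0 ?(ltW r_gt0) ?(ltW (beta_gt0 _)) //.
by rewrite -[leRHS]mul1r ler_pdivlMr // -mulrA.
Qed.


(** Compare with [1 / (1 - y)], using [1 - y <= expR (- y)]. *)
Lemma expR_le_1D2 (y : R) : 0 <= y <= 1 / 2 -> expR y <= 1 + 2 * y.
Proof.
move=> /andP [y_ge0 y_le].
have y1 : 0 < 1 - y by lra.
apply: (@le_trans _ _ (1 - y)^-1).
  rewrite -[leLHS]invrK -expRN lef_pV2 ?posrE ?expR_gt0 //; exact: expR_ge1Dx.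
by rewrite -[leLHS]mul1r ler_pdivrMr //; nra.
Qed.

(* The energy an edge loses when a colour other than its own is revealed at u. *)
Let drop c u e : R :=
  if [&& u \in e, unsatisfied c e & (0 < #|pinned c e|)%N]
  then energy #|pinned c e| else 0.

(** The energy regained when [a] is the edge's own colour. Edges without pinned vertices are
    excluded; the term [energy 1 + x] accounts for them. *)
Let kept c u a e : R :=
  if [&& u \in e, (0 < #|pinned c e|)%N & unsatisfied (pin c [set u] a) e]
  then energy #|pinned c e|.+1 else 0.

Let drop_ge0 c u e : 0 <= drop c u e.
Proof. by rewrite /drop; case: ifP => // /and3P [_ _ /energy_gt0/ltW]. Qed.

Let kept_ge0 c u a e : 0 <= kept c u a e.
Proof. by rewrite /kept; case: ifP => // _; exact/ltW/energy_gt0. Qed.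

Let kept_le c u a e : kept c u a e <= (u \in e)%:R * (2 * D%:R)^-1.
Proof.
have D2 : 0 <= (2 * D%:R)^-1 :> R by rewrite invr_ge0 mulr_ge0.
rewrite /kept; case: ifP => [/and3P [-> _ _]|_]; last by rewrite mulr_ge0.
by rewrite mul1r energy_le.
Qed.

Let edge_energy_pin1 c u a e : c u = None ->
  edge_energy (pin c [set u] a) e <=
  edge_energy c e + ((u \in e)%:R * (energy 1 + x) - drop c u e + kept c u a e).
Proof.
move=> cu; rewrite /drop /kept.
have cS : {in [set u], forall v, c v = None} by move=> v /set1P ->.
have y_ge0 : 0 <= energy 1 + x by rewrite addr_ge0 // ltW ?energy_gt0.
case: (boolP (u \in e)) => ue /=; last first.
  rewrite mul0r subr0 !addr0 (@eq_edge_energy _ c) //; apply: pin_notin.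
  by rewrite -setI_eq0; apply/eqP/setP => v; rewrite !inE; case: eqVneq => [->|];
     rewrite ?(negbTE ue) ?andbF.
rewrite /edge_energy pinned_pin1 // ue add1n mul1r.
case: (boolP (unsatisfied (pin c _ a) e)) => ua.
  rewrite (unsatisfied_pin cS ua) /=; case: (posnP #|pinned c e|) => [->|m_gt0] /=.
    rewrite subr0 addr0 {2}/energy eqxx; lra.
  lra.
rewrite andbF addr0; case: (boolP (unsatisfied c e)) => uc /=; last lra.
case: (posnP #|pinned c e|) => [->|m_gt0] /=; last lra.
have := energy_gt0 (ltn0Sn 0); rewrite {2}/energy eqxx; lra.
Qed.

(** Only one colour keeps [e] unsatisfied. It multiplies the energy by at most [r], while its [beta]
    is at most [1 / (4 r)]. *)
Let sum_kept c u e : c u = None ->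
  \sum_a beta a * kept c u a e <= drop c u e / 4.
Proof.
move=> cu.
case: (pickP (fun a => [&& u \in e, (0 < #|pinned c e|)%N
                         & unsatisfied (pin c [set u] a) e])) => [a|H]; last first.
  rewrite big1 ?divr_ge0 // => a _; by rewrite /kept H mulr0.
move=> /and3P [ue m_gt0 ua]; rewrite (bigD1 a) //= big1 ?addr0; last first.
  move=> b ba; rewrite /kept; case: ifP => [/and3P [_ _ ub]|_]; last by rewrite mulr0.
  by rewrite (unsatisfied_pin1_inj ue m_gt0 cu ua ub) eqxx in ba.
have cS : {in [set u], forall v, c v = None} by move=> v /set1P ->.
rewrite /drop /kept ue m_gt0 ua (unsatisfied_pin cS ua) /=.
apply: (@le_trans _ _ (beta a * (r * energy #|pinned c e|))).
  by rewrite ler_wpM2l ?energyS // ltW.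
have := energy_gt0 m_gt0; have := beta_le a; nra.
Qed.

(** Colour [a] multiplies the weight by at most [beta a * expR (Y - N + P a)]. Linearising in [P a]
    and summing over colours bounds the total factor by [expR (Y + eta - N / 2)], whose exponent is
    negative. *)
Lemma weight_reveal F c u e : F \subset E -> c u = None -> e \in F -> u \in e ->
  unsatisfied c e -> (h <= #|pinned c e|)%N ->
  \sum_a weight F (pin c [set u] a) < weight F c.
Proof.
move=> FE cu eF ue uc hm.
pose N := \sum_(f in F) drop c u f.
pose P a := \sum_(f in F) kept c u a f.
pose Y := D%:R * (energy 1 + x).
have cS : {in [set u], forall v, c v = None} by move=> v /set1P ->.
(* The edge [e] alone carries the capped energy, since it has at least [h] pinned vertices. *)
have N_ge : (2 * D%:R)^-1 <= N.
  rewrite /N (bigD1 e) //= /drop ue uc (leq_trans h_gt0 hm) /= /energy.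
  rewrite gtn_eqF ?(leq_trans h_gt0) // (eqP (hm : h - _ == 0)%N) expr0 invr1 mulr1.
  by rewrite lerDl sumr_ge0 // => f _; exact: drop_ge0.
have P_ge0 a : 0 <= P a by apply: sumr_ge0 => f _.
(* This is the range in which [expR_le_1D2] applies. *)
have P_le a : P a <= 1 / 2.
  have -> : 1 / 2 = D%:R * (2 * D%:R)^-1 :> R.
    by rewrite invfM mulrCA divff ?gt_eqF // mulr1 div1r.
  apply: le_trans (sum_incident u FE _); last by rewrite invr_ge0 mulr_ge0.
  by apply: ler_sum => f _; exact: kept_le.
have betaP : \sum_a beta a * P a <= N / 4.
  under eq_bigr do rewrite mulr_sumr.
  rewrite exchange_big /N mulr_suml; apply: ler_sum => f _; exact: sum_kept.
have W a : weight F (pin c [set u] a) <=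
    weight F c * expR (Y - N) * (beta a * (1 + 2 * P a)).
  rewrite /weight prod_pin // cards1 expr1.
  set A := \prod_v _; set B := \sum_(f in F) edge_energy c f.
  have A_ge0 : 0 <= A.
    by apply: prodr_ge0 => v _; case: (c v) => [b|] //=; exact: ltW.
  have sumE : \sum_(f in F) edge_energy (pin c [set u] a) f <= B + (Y - N + P a).
    apply: (@le_trans _ _ (\sum_(f in F) (edge_energy c f + ((u \in f)%:R *
                 (energy 1 + x) - drop c u f + kept c u a f)))).
      by apply: ler_sum => f _; exact: edge_energy_pin1.
    rewrite !big_split /= sumrN lerD2l lerD2r lerD2r; apply: sum_incident => //.
    by rewrite addr_ge0 // ltW ?energy_gt0.
  apply: (@le_trans _ _ (beta a * A * expR (B + (Y - N + P a)))).
    by rewrite ler_wpM2l ?ler_expR // mulr_ge0 // ltW.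
  rewrite 2!expRD; move: (expR (Y - N)) (expR_ge0 (Y - N)) => z z_ge0.
  have := @expR_le_1D2 (P a); rewrite P_ge0 P_le => /(_ isT) H.
  rewrite [leRHS](_ : _ = (beta a * A * (expR B * z)) * (1 + 2 * P a)); last by ring.
  rewrite [expR B * _]mulrA [leLHS]mulrA.
  by rewrite ler_wpM2l // !mulr_ge0 ?expR_ge0 // ltW.
apply: (@le_lt_trans _ _ (weight F c * expR (Y - N) * \sum_a (beta a * (1 + 2 * P a)))).
  by rewrite mulr_sumr; apply: ler_sum => a _; exact: W.
rewrite -mulrA gtr_pMr ?weight_gt0 //.
have S_le : \sum_a beta a * (1 + 2 * P a) <= 1 + (eta + N / 2).
  under eq_bigr do rewrite mulrDr mulr1 mulrCA.
  rewrite big_split /= -mulr_sumr; move: sum_beta betaP; lra.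
apply: (@le_lt_trans _ _ (expR (Y - N) * expR (eta + N / 2))).
  by rewrite ler_wpM2l ?expR_ge0 // (le_trans S_le) // expR_ge1Dx.
rewrite -expRD expR_lt1.
have N4 : (4 * D%:R)^-1 <= N / 2.
  by rewrite ler_pdivlMr // (le_trans _ N_ge) // -[4]/(2 * 2)%:R natrM -mulrA
             invfM mulrAC mulVf // mul1r.
move: smallness N4; rewrite -/Y; lra.
Qed.

End Weights.

(** * The maximum principle for the ratio of |Z| to the weight *)

Section MaximumPrinciple.

Variables (V : finType) (q : nat) (R : realType) (w : 'I_q -> R[i]).
Variables (beta : 'I_q -> R) (r x eta : R) (D h k : nat) (E : {set {set V}}).
Implicit Types (c : {ffun V -> option 'I_q}) (e : {set V}) (F : {set {set V}}).

Hypotheses (D_gt0 : (0 < D)%N) (h_gt0 : (0 < h)%N) (h_lt_k : (h < k)%N).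
Hypotheses (q_gt0 : (0 < q)%N) (r_ge1 : 1 <= r) (x_ge0 : 0 <= x) (eta_ge0 : 0 <= eta).
Hypotheses (beta_gt0 : forall a, 0 < beta a).
Hypotheses (beta_le : forall a, beta a * (4 * r) <= 1).
Hypotheses (sum_beta : \sum_a beta a <= 1 + eta).
Hypotheses (deg_le : forall v, (#|[set e in E | v \in e]| <= D)%N).
Hypothesis uniformE : uniform E k.
Hypothesis smallness : D%:R * (energy r x D h 1 + x) + eta < (4 * D%:R)^-1.
Hypothesis w_lt : forall a, normc (w a) < beta a * normc (\sum_b w b).
Hypothesis r_expn_le : r ^- (k - h) <= (2 * D%:R)^-1.
Hypothesis expR_lt : expR (- x) < 1 - q%:R * r ^- k.

Local Notation uncolored := ([ffun=> None] : {ffun V -> option 'I_q}).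
Local Notation Z := (partition_function w).
Local Notation W := (weight beta r x D h).

Lemma normc_ge0 (z : R[i]) : 0 <= normc z.
Proof. by case: z => a b; rewrite /= sqrtr_ge0. Qed.

Lemma le_normc_sum (I : finType) (f : I -> R[i]) :
  normc (\sum_i f i) <= \sum_i normc (f i).
Proof.
elim/big_ind2: _ => [|y z t u yz tu|//]; first by rewrite normc0.
by rewrite (le_trans (le_normcD _ _)) // lerD.
Qed.

(** Without constraints the sum factors over vertices, and strictness in [w_lt] excludes a vanishing
    total weight. *)
Lemma partition_function_set0_neq0 : Z set0 uncolored != 0.
Proof.
have -> : Z set0 uncolored = \prod_(v : V) \sum_a w a.
  rewrite bigA_distr_bigA /=; apply: eq_bigl => s; apply/andP; split.
    by apply/forall_inP => e; rewrite inE.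
  by apply/forallP => v; rewrite /compatible ffunE.
apply/prodf_neq0 => v _; apply: contraTneq (w_lt (Ordinal q_gt0)) => ->.
by rewrite normc0 mulr0 -leNgt normc_ge0.
Qed.

Section Maximizer.

Variables (M : R) (F : {set {set V}}) (c : {ffun V -> option 'I_q}).
Hypotheses (M_gt0 : 0 < M) (FE : F \subset E).
Hypothesis bound : forall F' c', F' \subset E -> normc (Z F' c') <= M * W F' c'.
Hypothesis maxFc : normc (Z F c) = M * W F c.

(** Otherwise revealing a further vertex of [e] bounds |Z| by [M] times a sum of weights strictly
    below [W F c], against maximality. *)
Lemma pinned_lt e : e \in F -> unsatisfied c e -> (#|pinned c e| < h)%N.
Proof.
move=> eF ec; rewrite ltnNge; apply/negP => hm.
case: (pickP (mem (unpinned c e))) => [u|full].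
  rewrite !inE => /andP [ue /eqP cu].
  have lt := weight_reveal D_gt0 h_gt0 r_ge1 x_ge0 beta_gt0 beta_le
               sum_beta deg_le smallness FE cu eF ue ec hm.
  have : M * W F c <= M * \sum_a W F (pin c [set u] a).
    rewrite -maxFc (partition_function_reveal w F cu) (le_trans (le_normc_sum _)) //.
    by rewrite mulr_sumr; apply: ler_sum => a _; exact: bound.
  by rewrite ler_pM2l // leNgt lt.
(* With all of [e] pinned to one colour, no proper colouring extends [c], so Z would vanish. *)
have : 0 < normc (Z F c) by rewrite maxFc mulr_gt0 ?weight_gt0.
rewrite /partition_function big1 ?normc0 ?ltxx // => s.
suff -> : proper_coloring F s && extends c s = false by [].
apply/negbTE/negP => /andP [/forall_inP /(_ e eF) + /forallP cs]; apply/negP; rewrite negbK.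
case/existsP: ec => a /forall_inP ca; apply/existsP; exists a.
apply/forall_inP => v ve; have := full v; rewrite !inE ve /= => cv.
have := ca v ve; have := cs v.
by rewrite /compatible cv /= => /eqP -> /eqP [->].
Qed.

Lemma weightD1 e c' : e \in F ->
  W F c' = expR (edge_energy r x D h c' e) * W (F :\ e) c'.
Proof.
move=> eF; rewrite /weight (big_setD1 e) //= expRD; ring.
Qed.

(** Deleting [e] gives [|Z| <= M W' (1 + r ^- (k - m))], but maximality makes |Z| equal to
    [M W' expR (energy m)], which is larger. *)
Lemma pinned_eq0 e : e \in F -> unsatisfied c e -> #|pinned c e| = 0%N.
Proof.
move=> eF ec; have mh := pinned_lt eF ec.
apply/eqP; rewrite -leqn0 leqNgt; apply/negP => m_gt0.
have [v] := card_gt0P m_gt0; rewrite !inE => /andP [ve cv].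
have /existsP [a /forall_inP ca] := ec.
have cva : c v = Some a.
  by have := ca v ve; rewrite /compatible (negbTE cv) /= => /eqP.
have F'E : F :\ e \subset E by apply: subset_trans FE; exact: subD1set.
have := maxFc; rewrite -{1}(setD1K eF).
rewrite (partition_function_setU1_pinned w _ ve cva ca).
rewrite (weightD1 c eF) /edge_energy ec => eqM.
have cU : {in unpinned c e, forall u, c u = None}.
  by move=> u; rewrite !inE => /andP [_ /eqP].
have := weight_pin_le D_gt0 r_ge1 x_ge0 eta_ge0 beta_gt0 beta_le deg_le
          smallness a F'E cU.
have -> : (#|unpinned c e| = k - #|pinned c e|)%N.
  by rewrite -(uniformE (subsetP FE _ eF)) -(card_pinned_unpinned c e) addKn.
move: mh m_gt0 eqM; set m := #|pinned c e|; set W' := W (F :\ e) c => mh m_gt0 eqM Wp.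
have W'_gt0 : 0 < W' by exact: weight_gt0.
have : M * (expR (energy r x D h m) * W') <= M * W' + M * (r ^- (k - m) * W').
  rewrite -eqM (le_trans (le_normcD _ _)) // normcN lerD ?bound //.
  by rewrite (le_trans (bound _ _)) // ler_pM2l.
rewrite -mulrDr ler_pM2l // -{2}[W']mul1r -mulrDl ler_pM2r //; apply/negP; rewrite -ltNge.
have en_gt0 := energy_gt0 x h D_gt0 r_ge1 m_gt0.
apply: le_lt_trans (expR_gt1Dx _); last by rewrite gt_eqF.
rewrite lerD2l /energy (gtn_eqF m_gt0).
have r_gt0 : 0 < r by exact: lt_le_trans r_ge1.
(* The first part of the exponent pays for [1 / (2 D)], and the second is exactly the geometric
   factor of the energy. *)
have -> : (k - m = (k - h) + (h - m))%N by rewrite addnBA ?subnK // ltnW.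
by rewrite exprD invfM ler_wpM2r // invr_ge0 exprn_ge0 // ltW.
Qed.

(** The edges at a pinned [u] are all satisfied, so dropping the satisfied edges changes neither Z
    nor W. Unpinning [u] then contradicts the strict inequality [w_lt]. *)
Lemma unpinned_maximizer : c = uncolored.
Proof.
apply/ffunP => u; rewrite ffunE; case cu: (c u) => [a|//]; exfalso.
pose F' := [set e in F | unsatisfied c e].
have F'E : F' \subset E.
  by apply: subset_trans FE; apply/subsetP => e; rewrite inE => /andP [].
have F'u : {in F', forall e, u \notin e}.
  move=> e; rewrite inE => /andP [eF ec]; apply/negP => ue.
  have := pinned_eq0 eF ec; apply/eqP; rewrite -lt0n; apply/card_gt0P.
  by exists u; rewrite !inE ue cu.
have W'E : W F c = beta a * W F' (unpin c u).
  rewrite /weight (bigD1 u) //= cu /= [in RHS](bigD1 u) //= ffunE eqxx /= mul1r -mulrA.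
  congr (_ * (_ * expR _)).
    by apply: eq_bigr => v vu; rewrite ffunE (negbTE vu).
  rewrite (bigID (unsatisfied c)) /= addrC big1 ?add0r => [|e /andP [_]]; last first.
    by rewrite /edge_energy => /negbTE ->.
  apply: eq_big => [e|e /andP [eF ec]]; first by rewrite inE.
  apply: eq_edge_energy => v ve; rewrite ffunE; case: eqVneq => // vu.
  by have := F'u e; rewrite inE eF ec -vu ve => /(_ isT).
have := congr1 (@normc R) (partition_function_unpin w cu F'u).
rewrite !normcM -partition_function_satisfied maxFc W'E => eqQ.
have W0 : 0 < W F' (unpin c u) by exact: weight_gt0.
have : normc (w a) * normc (Z F' (unpin c u)) <= normc (w a) * (M * W F' (unpin c u)).
  by rewrite ler_wpM2l ?normc_ge0 // bound.
rewrite -eqQ [X in X <= _](_ : _ = (beta a * normc (\sum_b w b)) * (M * W F' (unpin c u))).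
  by rewrite ler_pM2r ?(mulr_gt0 M_gt0 W0) // leNgt w_lt.
ring.
Qed.

(** A missing edge would give [|Z| <= M W (expR (- x) + q r ^- k)], where the bracket is below 1 by
    [expR_lt]. *)
Lemma full_maximizer : F = E.
Proof.
apply/eqP; rewrite eqEsubset FE /=; apply/subsetP => e eE.
apply: contraT => eF.
have cN v : c v = None by rewrite unpinned_maximizer ffunE.
have e_neq0 : e != set0 by rewrite -card_gt0 (uniformE eE) (leq_ltn_trans _ h_lt_k).
have eFE : e |: F \subset E by rewrite subUset sub1set eE.
have p0 : #|pinned c e| = 0%N.
  by apply: eq_card0 => v; rewrite !inE cN andbF.
have ec : unsatisfied c e.
  apply/existsP; exists (Ordinal q_gt0); apply/forall_inP => v _.
  by rewrite /compatible cN.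
have WE : W (e |: F) c = expR (- x) * W F c.
  rewrite /weight big_setU1 //= expRD /edge_energy ec p0 /energy eqxx; ring.
have ZE := partition_function_setU1_unpinned w F e_neq0 (in1W cN).
have : M * W F c <= M * (expR (- x) * W F c) + \sum_(a < q) M * (r ^- k * W F c).
  rewrite -maxFc -WE.
  have -> : Z F c = Z (e |: F) c + \sum_a Z F (pin c e a) by rewrite ZE subrK.
  rewrite (le_trans (le_normcD _ _)) // lerD ?bound // (le_trans (le_normc_sum _)) //.
  apply: ler_sum => a _; rewrite (le_trans (bound _ _)) // ler_pM2l //.
  rewrite -(uniformE eE).
  exact: (weight_pin_le D_gt0 r_ge1 x_ge0 eta_ge0 beta_gt0 beta_le deg_le
          smallness a FE (in1W cN)).
rewrite sumr_const card_ord -[_ *+ q]mulr_natl [q%:R * _]mulrCA -mulrDr ler_pM2l //.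
rewrite [q%:R * _]mulrA -mulrDl -{1}[W F c]mul1r ler_pM2r ?weight_gt0 // => H.
by move: expR_lt; lra.
Qed.

End Maximizer.

Lemma partition_function_neq0 : Z E uncolored != 0.
Proof.
pose ratio (p : {set {set V}} * {ffun V -> option 'I_q}) :=
  normc (Z p.1 p.2) / W p.1 p.2.
have W_gt0 F c : 0 < W F c by exact: weight_gt0.
have P0 : (set0 : {set {set V}}, uncolored).1 \subset E.
  exact: sub0set.
pose sub (p : {set {set V}} * {ffun V -> option 'I_q}) := p.1 \subset E.
case: (@Order.TotalTheory.arg_maxP _ _ _ _ sub ratio P0) => -[F c] /= FE maxM; pose M := ratio (F, c).
have bound F' c' : F' \subset E -> normc (Z F' c') <= M * W F' c'.
  by move=> F'E; rewrite -ler_pdivrMr //; exact: (maxM (F', c')).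
have M_gt0 : 0 < M.
  have := bound set0 uncolored P0; rewrite leNgt => /negP H.
  rewrite ltNge; apply/negP => M_le0; apply: H.
  apply: (@le_lt_trans _ _ 0); first by rewrite mulr_le0_ge0 // ltW.
  rewrite lt_neqAle normc_ge0 andbT eq_sym; apply/eqP => /eq0_normc /eqP.
  exact/negP/partition_function_set0_neq0.
have maxFc : normc (Z F c) = M * W F c by rewrite /M /ratio /= divfK // gt_eqF.
rewrite -(full_maximizer M_gt0 FE bound maxFc) -(unpinned_maximizer M_gt0 FE bound maxFc).
apply: contraTneq (mulr_gt0 M_gt0 (W_gt0 F c)) => Z0.
by rewrite -maxFc Z0 normc0 ltxx.
Qed.

End MaximumPrinciple.

(** * Numerical estimates from the lower bound on q *)

Section Numerics.

Variables (R : realType) (k D q : nat).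
Hypotheses (k_ge : (50 <= k)%N) (D_gt0 : (1 <= D)%N).
Hypothesis q_ge : 700 * (D%:R `^ (5 / (k%:R - 10))) <= q%:R :> R.

Local Notation h := (k %/ 5)%N.
Local Notation r := (q%:R / 5 : R).
Local Notation x := (2 * (q%:R * r ^- k)).
Local Notation delta := (1 / (16 * D%:R ^+ 2 * k%:R ^+ 5) : R).

Let D_ge1 : 1 <= D%:R :> R.
Proof. by rewrite ler1n. Qed.

Let p_ge1 : 1 <= D%:R `^ (5 / (k%:R - 10)) :> R.
Proof.
rewrite -[leLHS](powRr0 (D%:R : R)).
by apply: ler_powR => //; rewrite divr_ge0 // subr_ge0 ler_nat; lia.
Qed.

Lemma quotient_ge140 : 140 <= r.
Proof. move: q_ge p_ge1; lra. Qed.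

Let r_gt0 : 0 < r.
Proof. by apply: lt_le_trans quotient_ge140. Qed.

(* 5 (k/5 - 1) >= k - 9, which beats the exponent k - 10 in the bound on q. *)
Lemma quotient_expn_ge : 140 * D%:R <= r ^+ h.-1.
Proof.
set p := D%:R `^ (5 / (k%:R - 10)) : R.
have rp : 140 * p <= r by move: q_ge; rewrite -/p; lra.
apply: (@le_trans _ _ ((140 * p) ^+ h.-1)); last first.
  by rewrite lerXn2r // nnegrE ?(ltW r_gt0) // mulr_ge0 // powR_ge0.
rewrite exprMn ler_pM //; first by rewrite -{1}(expr1 140) ler_weXn2l //; [lra | lia].
rewrite -powR_mulrn ?powR_ge0 // -powRrM -{1}(powRr1 (ler0n R D)).
apply: ler_powR => //.
have k10 : 0 < k%:R - 10 :> R by rewrite subr_gt0 ltr_nat; lia.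
rewrite mulrAC ler_pdivlMr // mul1r -natrM lerBlDr -natrD ler_nat; lia.
Qed.

Let quotient_expn_ge2 m : (2 * h.-1 < m)%N -> 140 ^+ 3 * D%:R ^+ 2 <= r ^+ m.
Proof.
move=> hm; have -> : (m = h.-1 + h.-1 + (m - 2 * h.-1))%N by lia.
have H1 : 140 <= r ^+ (m - 2 * h.-1).
  apply: le_trans quotient_ge140 _; rewrite -{1}(expr1 r) ler_weXn2l //; last lia.
  by move: quotient_ge140; lra.
rewrite !exprD (_ : _ * _ = 140 * D%:R * (140 * D%:R) * 140); last by ring.
by rewrite ler_pM ?mulr_ge0 // ler_pM ?mulr_ge0 // quotient_expn_ge.
Qed.

Lemma mono_weightE : q%:R * r ^- k = 5 * r ^- k.-1.
Proof.
have -> : (k = k.-1.+1)%N by lia.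
rewrite /= exprS invfM mulrA; congr (_ * _).
by rewrite invfM invrK mulrA divff ?mul1r // gt_eqF //; move: r_gt0; lra.
Qed.

Let rV_le m : (2 * h.-1 < m)%N -> r ^- m * (140 ^+ 3 * D%:R ^+ 2) <= 1.
Proof.
by move=> /quotient_expn_ge2 H; rewrite mulrC ler_pdivrMr ?exprn_gt0 // mul1r.
Qed.

Let mono_weight_ge0 : 0 < r ^- k.-1.
Proof. by rewrite invr_gt0 exprn_gt0. Qed.

(** With [t = q r ^- k], the factor 2 in [x] gives [expR (- 2 t) <= 1 / (1 + 2 t) < 1 - t] for
    [0 < t < 1/2]. *)
Lemma expR_mono_weight : expR (- x) < 1 - q%:R * r ^- k.
Proof.
have y_gt0 := mono_weight_ge0.
have y_le : r ^- k.-1 * (140 ^+ 3 * D%:R ^+ 2) <= 1 by apply: rV_le; lia.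
have D2 : 1 <= D%:R ^+ 2 :> R by rewrite exprn_ege1.
rewrite mono_weightE; set y := r ^- k.-1 in y_gt0 y_le *.
have {}y_le : y * 100 <= 1.
  by apply: le_trans y_le; rewrite ler_pM2l //; lra.
rewrite expRN; apply: (@le_lt_trans _ _ (1 + 2 * (5 * y))^-1).
  rewrite lef_pV2 ?posrE ?expR_gt0 ?expR_ge1Dx //; lra.
rewrite -[ltLHS]mul1r ltr_pdivrMr; last lra.
nra.
Qed.

Lemma delta_gt0 : 0 < delta.
Proof.
have D_pos : 0 < D%:R :> R by exact: lt_le_trans D_ge1.
have k_pos : 0 < k%:R :> R by rewrite ltr0n; lia.
by rewrite divr_gt0 // !mulr_gt0.
Qed.

Lemma delta_le : delta * (800 * D%:R) <= 1.
Proof.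
(* The constant 800 is 16 times this 50; one of the two factors [D] is given away. *)
have k5 : 50 <= k%:R ^+ 5 :> R.
  apply: (@le_trans _ _ (k%:R ^+ 1)); first by rewrite expr1 ler_nat.
  by rewrite ler_weXn2l // ler1n; lia.
have D2 : D%:R <= D%:R ^+ 2 :> R by rewrite -{1}(expr1 D%:R) ler_weXn2l.
rewrite mul1r mulrC ler_pdivrMr ?mul1r; last first.
  by rewrite !mulr_gt0 // ltr0n ?(leq_trans _ k_ge).
move: D_ge1 D2 k5; set d := D%:R; nra.
Qed.

(** After multiplication by [4 D] the three terms are at most 1/70, [40 / 140 ^ 3] and 12/800. *)
Lemma smallness_numerics :
  D%:R * (energy r x D h 1 + x) + 3 * delta < (4 * D%:R)^-1.
Proof.
have d_gt0 : 0 < D%:R :> R by exact: lt_le_trans D_ge1.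
have en : D%:R * energy r x D h 1 = r ^- h.-1 / 2.
  by rewrite /energy /= subn1 mulrA invfM mulrCA divff ?gt_eqF // mulr1 mulrC.
rewrite mulrDr en mono_weightE.
have y_le : r ^- k.-1 * (140 ^+ 3 * D%:R ^+ 2) <= 1 by apply: rV_le; lia.
have z_le : r ^- h.-1 * (140 * D%:R) <= 1.
  by rewrite mulrC ler_pdivrMr ?exprn_gt0 // mul1r quotient_expn_ge.
rewrite -[ltRHS]mul1r ltr_pdivlMr ?mulr_gt0 //.
move: y_le z_le delta_le; move: (r ^- k.-1) (r ^- h.-1) delta d_gt0 => y z d.
rewrite expr2; move: (D%:R : R) => DD; nra.
Qed.

Lemma expn_numerics : r ^- (k - h) <= (2 * D%:R)^-1.
Proof.
have d_gt0 : 0 < D%:R :> R by exact: lt_le_trans D_ge1.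
rewrite lef_pV2 ?posrE ?(exprn_gt0 _ r_gt0) ?mulr_gt0 //.
apply: (@le_trans _ _ (r ^+ h.-1)).
  by apply: le_trans quotient_expn_ge; rewrite ler_pM2r //; lra.
by rewrite ler_weXn2l //; [move: quotient_ge140; lra | lia].
Qed.

End Numerics.

(** * Colour weights near a real parameter in [0, 1] *)

Section VertexWeights.

Variables (R : realType) (q : nat) (lambda : R[i]) (lc d : R).
Hypotheses (q_ge : 700 <= q%:R :> R) (lc01 : 0 <= lc <= 1).
Hypotheses (d_gt0 : 0 < d) (d_le : 800 * d <= 1).
Hypothesis lambda_near : normc (lambda - lc%:C) <= d.

Definition color_weight (a : 'I_q) : R[i] := if val a == 0%N then lambda else 1.

(* The ideal weight w_a / sum_b w_b at lambda = lc, enlarged so that it strictly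
   exceeds |w_a| / |sum_b w_b| for every lambda within d of lc. *)
Definition color_bound (a : 'I_q) : R :=
  ((if val a == 0%N then lc else 1) + 2 * d) / (q%:R - 1 + lc - d).

Let q_gt0 : (0 < q)%N.
Proof. by rewrite -(ltr0n R); move: q_ge; lra. Qed.

Lemma sum_color (T : nmodType) (y z : T) :
  \sum_(a < q) (if val a == 0%N then y else z) = y + z *+ q.-1.
Proof.
rewrite -(prednK q_gt0) big_ord_recl /=; congr (_ + _).
by rewrite sumr_const card_ord.
Qed.

Let B_gt0 : 0 < q%:R - 1 + lc - d.
Proof. by move: q_ge lc01 d_le; lra. Qed.

Lemma color_bound_gt0 a : 0 < color_bound a.
Proof.
by rewrite divr_gt0 //; case: ifP => _; move: lc01 d_gt0; lra.
Qed.

(** The bound is close to [1 / q] at most, so the fifth of [q] left over absorbs all corrections. *)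
Lemma color_bound_le a : color_bound a * (4 * (q%:R / 5)) <= 1.
Proof.
rewrite mulrAC ler_pdivrMr // mul1r.
by case: ifP => _; move: lc01 d_gt0 d_le q_ge; nra.
Qed.

Let q1E : q.-1%:R = q%:R - 1 :> R.
Proof. by rewrite -[in RHS](prednK q_gt0) -natr1 addrK. Qed.

Lemma sum_color_bound : \sum_a color_bound a <= 1 + 3 * d.
Proof.
rewrite -mulr_suml big_split /= sum_color sumr_const card_ord -[_ *+ q]mulr_natl q1E.
rewrite ler_pdivrMr //.
by move: lc01 d_gt0 d_le q_ge; nra.
Qed.

Lemma normc_real (y : R) : 0 <= y -> normc y%:C = y.
Proof. by move=> y_ge0; rewrite /= expr0n /= addr0 sqrtr_sqr ger0_norm. Qed.

(** The triangle inequality bounds the total weight below by the denominator of [color_bound] and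
    each [|w a|] by its numerator minus at least [d]. *)
Lemma normc_color_weight a :
  normc (color_weight a) < color_bound a * normc (\sum_b color_weight b).
Proof.
have sum_ge : q%:R - 1 + lc - d <= normc (\sum_b color_weight b).
  rewrite sum_color lerBlDr.
  have -> : q%:R - 1 + lc = normc (q.-1%:R + lc)%:C.
    by rewrite normc_real q1E //; move: q_ge lc01; lra.
  have -> : (q.-1%:R + lc)%:C = (lambda + 1 *+ q.-1) - (lambda - lc%:C) :> R[i].
    by rewrite rmorphD /= rmorph_nat; ring.
  by rewrite (le_trans (le_normcD _ _)) // normcN lerD2l.
apply: (@lt_le_trans _ _ (color_bound a * (q%:R - 1 + lc - d))); last first.
  by rewrite ler_pM2l // color_bound_gt0.
rewrite {1}/color_bound divfK ?(gt_eqF B_gt0) // /color_weight; case: ifP => _; last first.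
  have -> : normc (1 : R[i]) = 1 by exact: normc1.
  by move: d_gt0; lra.
have -> : lambda = lc%:C + (lambda - lc%:C) by ring.
apply: le_lt_trans (le_normcD _ _) _; rewrite normc_real; last by case/andP: lc01.
by move: lambda_near d_gt0; lra.
Qed.

End VertexWeights.

(** * Specialization to the hypergraph colouring partition function *)

Lemma Zco_partition_function (V : finType) (E : {set {set V}}) (R : realType)
    (q : nat) (lambda : R[i]) :
  Zco E q lambda = partition_function (color_weight lambda) E
    ([ffun=> None] : {ffun V -> option 'I_q}).
Proof.
apply: eq_big => [s|s _].
  rewrite (_ : extends _ s) ?andbT //; apply/forallP => v.
  by rewrite /compatible ffunE.
rewrite -prodr_const big_mkcond /=; apply: eq_bigr => v _.
by rewrite inE.
Qed.

Theorem theorem1p1 (R : realType) (k Delta q : nat)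
    (hk : (50 <= k)%N) (hDelta : (1 <= Delta)%N)
    (hq : 700 * (Delta%:R `^ (5 / (k%:R - 10))) <= q%:R :> R)
    (V : finType) (E : {set {set V}})
    (hunif : uniform E k) (hdeg : max_degree E = Delta)
    (lambda : R[i])
    (hlambda : exists lambda_c : R, 0 <= lambda_c <= 1 /\
       `|lambda - lambda_c%:C| <= (1 / (16 * Delta%:R ^+ 2 * k%:R ^+ 5))%:C) :
  Zco E q lambda <> 0.
Proof.
case: hlambda => lc [lc01 lambda_near].
pose d : R := 1 / (16 * Delta%:R ^+ 2 * k%:R ^+ 5).
have D_ge1 : 1 <= Delta%:R :> R by rewrite ler1n.
have r_ge140 := quotient_ge140 hk hDelta hq.
have q_ge : 700 <= q%:R :> R by move: r_ge140; lra.
have d_gt0 : 0 < d := delta_gt0 hk hDelta hq.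
(* The norm of [R[i]] takes values in [R[i]]; the estimate is moved to [R]. *)
have {}lambda_near : normc (lambda - lc%:C) <= d by rewrite -lecR.
have := delta_le hk hDelta hq; rewrite -/d => d_le'.
have {d_le'} d_le : 800 * d <= 1.
  move: d d_gt0 d_le' {lambda_near} => d d_gt0 d_le'.
  by apply: le_trans d_le'; rewrite mulrC ler_pM2l //; lra.
rewrite Zco_partition_function; apply/eqP.
(* Here [r = q / 5] leaves room in [color_bound_le], and [eta = 3 d] is the excess in
   [sum_color_bound]. *)
apply: (@partition_function_neq0 _ _ _ _ (color_bound lc d) (q%:R / 5)
          (2 * (q%:R * (q%:R / 5) ^- k)) (3 * d) Delta (k %/ 5) k) => //.
- by rewrite divn_gt0 // (leq_trans _ hk).
- by rewrite ltn_Pdiv // (leq_trans _ hk).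
- by rewrite -(ltr0n R); move: q_ge; lra.
- by move: r_ge140; lra.
- by rewrite !mulr_ge0 // invr_ge0 exprn_ge0 // divr_ge0.
- exact: color_bound_gt0.
- exact: color_bound_le.
- exact: sum_color_bound.
- by move=> v; rewrite -hdeg; exact: (leq_bigmax v).
- exact: smallness_numerics.
- exact: normc_color_weight.
- exact: expn_numerics.
- exact: (expR_mono_weight hk hDelta hq).
Qed.
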